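(* Let $G$ be an abstract snake graph with $d\ge1$ tiles whose labels are specialized by $b:=i_d$, $w:=i_1$, $z:=a$ (so the west edge of $G_1$ is labeled $i_d$, the $w$-edge of $G_d$ is labeled $i_1$, and the $z$-edge of $G_d$ is labeled $a$). Let $\mathcal S$ be the set of perfect matchings of $G$ that contain the south edge of $G_1$ or the $z$-edge of $G_d$ (its north edge if $d$ is even, its east edge if $d$ is odd). Then $$\sum_{P\in\mathcal S}\frac{x(P)h(P)}{x_a}=x_{i_1}\cdots x_{i_d}\;\mathrm{tr}\!\left(\begin{pmatrix}\frac{x_{i_1}}{x_{i_d}}&x_a\mathsf y_{i_d}\\0&\frac{\mathsf y_{i_d}x_{i_d}}{x_{i_1}}\end{pmatrix}M_d\right).$$ Equivalently, the left-hand side is the generating function $\sum_{\widetilde P} x(\widetilde P)h(\widetilde P)$ over good matchings $\widetilde P$ of the band graph obtained from $G$ by identifying the south edge of $G_1$ with the $z$-edge of $G_d$ (each good matching corresponding to the unique $P\in\mathcal S$ obtained by adding back the missing copy/copies of this identified edge, with $x(\widetilde P)=x(P)/x_a$ and $h(\widetilde P)=h(P)$).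
   Context: Abstract snake graph with $d\ge 1$ tiles: unit squares $G_1,\dots,G_d$ in the plane with $G_1=[0,1]^2$ and, for $1\le j\le d-1$, $G_{j+1}$ equal to the translate of $G_j$ either by $(0,1)$ (''$G_{j+1}$ north of $G_j$'') or by $(1,0)$ (''$G_{j+1}$ east of $G_j$''). The graph $G$ has as vertices the corners and as edges the sides of these squares (a shared side is one edge). Edges carry labels from some label set (labels need not be distinct): the south edge of $G_1$ is labeled $a$ and the west edge of $G_1$ is labeled $b$; for $1\le j\le d-1$, the edge shared by $G_j$ and $G_{j+1}$ is labeled $a_j$, and if $G_{j+1}$ is north of $G_j$ then the east edge of $G_j$ is labeled $i_{j+1}$ and the west edge of $G_{j+1}$ is labeled $i_j$, while if $G_{j+1}$ is east of $G_j$ then the north edge of $G_j$ is labeled $i_{j+1}$ and the south edge of $G_{j+1}$ is labeled $i_j$; finally, if $d$ is odd the north edge of $G_d$ is labeled $w$ and its east edge $z$, and if $d$ is even the east edge of $G_d$ is labeled $w$ and its north edge $z$. The tile $G_j$ itself carries the label $i_j$. To each label $\ell$ attach commuting indeterminates $x_\ell$ and (for the tile labels) $\mathsf y_\ell$. For a perfect matching $P$ of $G$, its weight is $x(P)=\prod_{e\in P}x_{\mathrm{label}(e)}$. Let $P_-$ (the minimal matching) be the unique perfect matching of $G$ consisting only of edges on the boundary of $G_1\cup\dots\cup G_d$ and containing the south edge of $G_1$. For every perfect matching $P$, the symmetric difference $P\ominus P_-$ is the set of boundary edges of a union of cycles enclosing a set of tiles $\{G_j: j\in J(P)\}$; the height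 monomial is $h(P)=\prod_{j\in J(P)}\mathsf y_{i_j}$. Matrix of $G$: for $1\le j\le d-1$, let $m_j=\begin{pmatrix}1&0\\ \frac{x_{a_j}}{x_{i_j}x_{i_{j+1}}}&\mathsf y_{i_j}\end{pmatrix}$ if either ($j$ is odd and $G_{j+1}$ is north of $G_j$) or ($j$ is even and $G_{j+1}$ is east of $G_j$), and $m_j=\begin{pmatrix}\frac{x_{i_{j+1}}}{x_{i_j}}&x_{a_j}\mathsf y_{i_j}\\0&\frac{x_{i_j}\mathsf y_{i_j}}{x_{i_{j+1}}}\end{pmatrix}$ otherwise. Set $M_d=m_{d-1}\cdots m_1$ for $d\ge2$ and $M_1$ the $2\times 2$ identity matrix. Band graph and good matchings: identify the south edge of $G_1$, from $x=(0,0)$ to $y=(1,0)$, with the $z$-edge of $G_d$, gluing $x$ to the endpoint $x'$ of the $z$-edge which is the north-east corner of $G_d$ and $y$ to its other endpoint $y'$. A perfect matching of this band graph is good if either $x$ and $y$ are matched to each other, or the two matching edges at $x$ and at $y$ lie on the same side of the identified (cut) edge. $\mathrm{tr}$ denotes the trace. *)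

(* Defs.v *)
From HB Require Import structures.
From mathcomp Require Import all_boot all_order all_algebra.
Set Implicit Arguments. Unset Strict Implicit. Unset Printing Implicit Defensive.
Import Order.TTheory GRing.Theory Num.Theory.

(* Geometry.  A lattice point is (x, y) : nat * nat.  A unit edge is       *)
(* (x, y, true)  = horizontal edge from (x,y) to (x+1,y), or               *)
(* (x, y, false) = vertical edge from (x,y) to (x,y+1).                    *)
Definition point := (nat * nat)%type.
Definition edge := (nat * nat * bool)%type.

Definition edge_ends (e : edge) : point * point :=
  let: (x, y, h) := e in
  if h then ((x, y), (x.+1, y)) else ((x, y), (x, y.+1)).

Definition incident (v : point) (e : edge) : bool :=
  (v == (edge_ends e).1) || (v == (edge_ends e).2).

Definition sideS (p : point) : edge := (p.1, p.2, true).
Definition sideN (p : point) : edge := (p.1, p.2.+1, true).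
Definition sideW (p : point) : edge := (p.1, p.2, false).
Definition sideE (p : point) : edge := (p.1.+1, p.2, false).

Definition corners (p : point) : seq point :=
  [:: p; (p.1.+1, p.2); (p.1, p.2.+1); (p.1.+1, p.2.+1)].

Definition is_side (p : point) (e : edge) : bool :=
  e \in [:: sideS p; sideN p; sideW p; sideE p].

Section Snake.
(* Label type, number of tiles, shape and labels.  Indices are 1-based as
   in the paper: [north j] (1 <= j <= d-1) means G_{j+1} is north of G_j
   (otherwise it is east of G_j); [i j] is the label i_j (1 <= j <= d);
   [av j] is the label a_j (1 <= j <= d-1). *)
Variables (L : Type) (d : nat) (north : nat -> bool) (a : L)
          (i av : nat -> L).

(* south-west corner of the tile G_{k+1} (0-based index k) *)
Fixpoint pos0 (k : nat) : point :=
  if k is k'.+1 then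
    let p := pos0 k' in
    if north k then (p.1, p.2.+1) else (p.1.+1, p.2)
  else (0, 0).

Definition tpos (j : nat) : point := pos0 j.-1.

Definition lab_b := i d.
Definition lab_w := i 1.
Definition lab_z := a.

Definition zedge : edge := if odd d then sideE (tpos d) else sideN (tpos d).
Definition wedge : edge := if odd d then sideN (tpos d) else sideE (tpos d).

Definition pair_edges (j : nat) : seq (edge * L) :=
  if north j then
    [:: (sideN (tpos j), av j); (sideE (tpos j), i j.+1);
        (sideW (tpos j.+1), i j)]
  else
    [:: (sideE (tpos j), av j); (sideN (tpos j), i j.+1);
        (sideS (tpos j.+1), i j)].

(* The list of all (3d+1) edges of G, each listed exactly once,
   with their labels. *)
Definition ledges : seq (edge * L) :=
  [:: (sideS (tpos 1), a); (sideW (tpos 1), lab_b)]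
  ++ flatten [seq pair_edges j | j <- iota 1 d.-1]
  ++ [:: (wedge, lab_w); (zedge, lab_z)].

Definition nedges := (3 * d).+1.

Definition edge_at (k : 'I_nedges) : edge := (nth (sideS (tpos 1), a) ledges k).1.
Definition label_at (k : 'I_nedges) : L := (nth (sideS (tpos 1), a) ledges k).2.

Definition tile_pos (t : 'I_d) : point := tpos t.+1.

Definition perfect_matching (P : {set 'I_nedges}) : bool :=
  [forall t : 'I_d, all (fun v => #|[set k in P | incident v (edge_at k)]| == 1)
                        (corners (tile_pos t))].

Definition boundary_edge (k : 'I_nedges) : bool :=
  #|[set t : 'I_d | is_side (tile_pos t) (edge_at k)]| == 1.

Definition Pmin_spec (P : {set 'I_nedges}) : bool :=
  [&& perfect_matching P, [forall k in P, boundary_edge k] &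
      [exists k in P, edge_at k == sideS (tpos 1)]].

Definition Pmin : {set 'I_nedges} := odflt set0 [pick P | Pmin_spec P].

Definition tiles_boundary (J : {set 'I_d}) : {set 'I_nedges} :=
  [set k | odd #|[set t in J | is_side (tile_pos t) (edge_at k)]|].

Definition symdiff (P Q : {set 'I_nedges}) := (P :\: Q) :|: (Q :\: P).

(* J(P): the set of tiles enclosed by the cycles P (-) P_-, i.e. the set of
   tiles whose boundary is P (-) P_- *)
Definition enclosed (P : {set 'I_nedges}) : {set 'I_d} :=
  odflt set0 [pick J | tiles_boundary J == symdiff P Pmin].

Definition in_S (P : {set 'I_nedges}) : bool :=
  perfect_matching P &&
  ([exists k in P, edge_at k == sideS (tpos 1)] ||
   [exists k in P, edge_at k == zedge]).

Local Open Scope ring_scope.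
Variable F : fieldType.
Variables (x y : L -> F).

Definition weight (P : {set 'I_nedges}) : F := \prod_(k in P) x (label_at k).
Definition height (P : {set 'I_nedges}) : F :=
  \prod_(t in enclosed P) y (i t.+1).

Definition mx2 (p q r s : F) : 'M[F]_2 :=
  \matrix_(u < 2, v < 2)
    if u == ord0 then (if v == ord0 then p else q) else (if v == ord0 then r else s).

Definition mj (j : nat) : 'M[F]_2 :=
  if (odd j && north j) || (~~ odd j && ~~ north j) then
    mx2 1 0 (x (av j) / (x (i j) * x (i j.+1))) (y (i j))
  else
    mx2 (x (i j.+1) / x (i j)) (x (av j) * y (i j))
        0 (x (i j) * y (i j) / x (i j.+1)).

Fixpoint Mrec (k : nat) : 'M[F]_2 :=
  if k is k'.+1 then mj k *m Mrec k' else 1%:M.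

Definition Md : 'M[F]_2 := Mrec d.-1.

End Snake.

(* Main.v *)
(* A set of tiles is encoded by its indicator sequence g on 1, ..., d, extended by
   g 0 = 1 and g (d+1) = 0.  Flipping P_- along the boundary of this set of tiles
   gives a set of edges P, and whether an edge joining the level x + y = j to the
   next one lies in P depends only on g j and g (j+1).  Such a P is a perfect
   matching exactly when it has one edge between any two consecutive levels, which
   excludes a single value of each pair (g j, g (j+1)), and every perfect matching
   arises in this way.  Hence sums over perfect matchings are sums over paths of a
   two-state transfer matrix.  Membership in S excludes one value of (g d, g 1), so
   the cut edge contributes one more transition, from G_d back to G_1, and the sum
   over S is a trace.  The matrices m_j are the transfer matrices up to diagonal
   rescalings, which telescope into the product of the x_{i_j}. *)
Require Import Defs.
From HB Require Import structures.
From mathcomp Require Import all_boot all_order all_algebra.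
From mathcomp Require Import zify ring.
Set Implicit Arguments. Unset Strict Implicit. Unset Printing Implicit Defensive.
Import GRing.Theory.

(** * Lists made of consecutive triples *)

Lemma nth_flatten_triples (T : Type) (x0 : T) (f : nat -> seq T) m n k r :
  (forall j, size (f j) = 3) -> k < n -> r < 3 ->
  nth x0 (flatten [seq f j | j <- iota m n]) (3 * k + r) = nth x0 (f (m + k)) r.
Proof.
move=> f3; elim: n m k => // n IHn m [|k] ltkn ltr3 /=.
  by rewrite nth_cat f3 muln0 add0n addn0 ltr3.
rewrite nth_cat f3 ifF; last by lia.
have -> : 3 * k.+1 + r - 3 = 3 * k + r by lia.
by rewrite IHn // addSnnS.
Qed.

Lemma size_flatten_triples (T : Type) (f : nat -> seq T) m n :
  (forall j, size (f j) = 3) -> size (flatten [seq f j | j <- iota m n]) = 3 * n.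
Proof.
by move=> f3; elim: n m => // n IHn m /=; rewrite size_cat f3 IHn mulnS.
Qed.

(** * Levels, vertices and edges of the snake graph *)

Section Geometry.
Variables (d : nat) (north : nat -> bool).
Hypothesis d_gt0 : 0 < d.

(* The step from G_j to G_{j+1}.  The two ends of the snake count as steps too:
   G_1 is entered through its south edge, G_d is left through the z-edge. *)
Definition goN j := if j == 0 then true else if j == d then ~~ odd d else north j.

(* [before_edge j] is in P_- iff [par j], and [after_edge j] iff [~~ par j]. *)
Definition par j := goN j (+) odd j.

Lemma par0 : par 0. Proof. by []. Qed.

Lemma par_last : par d.
Proof. by rewrite /par /goN eqn0Ngt d_gt0 eqxx /=; case: odd. Qed.

Lemma goN_mid j : 0 < j < d -> goN j = north j.
Proof. by rewrite /goN => ?; rewrite !ifF //; lia. Qed.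

(* The points with x + y = j: the north-west ([true]) and south-east ([false])
   corners of G_j.  The levels 0 and d+1 consist of a single point, for which only
   the value of [b] allowed by [is_vertex] is meaningful. *)
Definition vertex j (b : bool) : point :=
  if j == 0 then (0, 0) else
  if j <= d then (if b then ((tpos north j).1, (tpos north j).2.+1)
                  else ((tpos north j).1.+1, (tpos north j).2))
  else ((tpos north d).1.+1, (tpos north d).2.+1).

(** At the two end levels the value kept is the one for which [shared_edge 0] and [shared_edge d]
    have their ends given by the same formula as the other shared edges. *)
Definition is_vertex j (b : bool) :=
  (j <= d.+1) && ((j == 0) ==> b) && ((j == d.+1) ==> (b != goN d)).

Lemma tpos_level j : 0 < j -> (tpos north j).1 + (tpos north j).2 = j.-1.
Proof.
case: j => // j _; rewrite /tpos /=; elim: j => // j /=.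
by case: north => /=; lia.
Qed.

Lemma vertex_level j b : j <= d.+1 -> (vertex j b).1 + (vertex j b).2 = j.
Proof.
rewrite /vertex => lejd; case: eqP => [->//|j0].
have Hj := @tpos_level j; have Hd := @tpos_level d.
by case: leqP => ? /=; last lia; case: b => /=; lia.
Qed.

Lemma vertex_eq j b l c : is_vertex j b -> is_vertex l c ->
  (vertex j b == vertex l c) = (j == l) && (b == c).
Proof.
move=> /andP[/andP[jd j0] jd1] /andP[/andP[ld l0] ld1].
have [ejl|neq_jl] := eqVneq j l; last first.
  apply/eqP=> eq_v; case/eqP: neq_jl.
  by rewrite -(vertex_level b jd) -(vertex_level c ld) eq_v.
rewrite -{}ejl in l0 ld1 ld *; have [->|neq_bc] := eqVneq b c; first by rewrite eqxx.
(* The end levels allow a single value, so two distinct values exclude them. *)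
have [jz jl] : j != 0 /\ j != d.+1.
  by split; apply/eqP => ej; move: j0 l0 jd1 ld1; rewrite ej !eqxx /=;
     move: neq_bc; case: b; case: c; case: goN.
have lejd : j <= d by lia.
rewrite /vertex (negbTE jz) lejd.
by apply/eqP; case: b c neq_bc {j0 l0 jd1 ld1} => [] [] //= _ []; lia.
Qed.

(** A north step starts G_{j+1} at the north-west corner of G_j, an east step at the south-east
    corner. *)
Lemma tpos_vertex j : j < d -> tpos north j.+1 = vertex j (goN j).
Proof.
move=> ltjd; rewrite /vertex; case: j ltjd => // j ltjd.
by rewrite goN_mid // (ltnW ltjd) /tpos /=; case: north.
Qed.

(* The edges between the levels j and j+1: the edge shared by G_j and G_{j+1}
   (the south edge of G_1 for j = 0, the z-edge for j = d), the other north or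
   east side of G_j (absent for j = 0), and the other south or west side of
   G_{j+1} (absent for j = d). *)
Definition shared_edge j : edge := (vertex j (goN j), goN j).
Definition before_edge j : edge := (vertex j (~~ goN j), ~~ goN j).
Definition after_edge j : edge := (vertex j (goN j), ~~ goN j).

(** This is the far end of the shared edge, which is horizontal after a north step and vertical
    after an east step. *)
Lemma vertexS_up j : j <= d ->
  vertex j.+1 (~~ goN j) =
  if goN j then ((vertex j (goN j)).1.+1, (vertex j (goN j)).2)
  else ((vertex j (goN j)).1, (vertex j (goN j)).2.+1).
Proof.
rewrite leq_eqVlt => /predU1P[->|ltjd].
  by rewrite /vertex /= ltnn leqnn eqn0Ngt d_gt0 /=; case: goN.
by rewrite -tpos_vertex // /vertex /= ltjd; case: goN.
Qed.

Lemma ends_shared j : j <= d ->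
  edge_ends (shared_edge j) = (vertex j (goN j), vertex j.+1 (~~ goN j)).
Proof.
move=> lejd; rewrite vertexS_up // /shared_edge.
by case: (vertex j _) => X Y /=; case: goN.
Qed.

Lemma ends_before j : 0 < j <= d ->
  edge_ends (before_edge j) = (vertex j (~~ goN j), vertex j.+1 (~~ goN j)).
Proof.
case/andP=> j0 lejd; rewrite vertexS_up // /before_edge /vertex.
by rewrite eqn0Ngt j0 lejd /=; case: goN.
Qed.

Lemma ends_after j : j < d ->
  edge_ends (after_edge j) = (vertex j (goN j), vertex j.+1 (goN j)).
Proof.
move=> ltjd; rewrite /after_edge -tpos_vertex // /vertex /= ltjd.
by case: (tpos _ _) => X Y /=; case: goN.
Qed.

Lemma is_vertex_goN j : j <= d -> is_vertex j (goN j).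
Proof.
move=> lejd; have /negPf jd1 : j != d.+1 by lia.
by rewrite /is_vertex jd1 leqW //= andbT; apply/implyP=> /eqP->.
Qed.

Lemma is_vertexS j b : j < d -> is_vertex j.+1 b.
Proof.
move=> ltjd; have /negPf jd1 : j.+1 != d.+1 by lia.
by rewrite /is_vertex jd1 ltnS ltnW.
Qed.

Lemma is_vertex_negN j : 0 < j <= d -> is_vertex j (~~ goN j).
Proof. by case: j => //= j ltjd; exact: is_vertexS. Qed.

Lemma is_vertexS_negN j : j <= d -> is_vertex j.+1 (~~ goN j).
Proof.
move=> lejd; rewrite /is_vertex /= ltnS lejd /= eqSS.
by apply/implyP=> /eqP->; case: goN.
Qed.

Definition incE := (vertex_eq, is_vertex_goN, is_vertex_negN,
                    is_vertexS_negN, is_vertexS).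

Lemma incident_shared l b j : is_vertex l b -> j <= d ->
  incident (vertex l b) (shared_edge j) =
  (l == j) && (b == goN j) || (l == j.+1) && (b != goN j).
Proof.
by move=> vl lejd; rewrite /incident ends_shared //= !incE //; case: b (goN j) {vl} => [] [].
Qed.

Lemma incident_before l b j : is_vertex l b -> 0 < j <= d ->
  incident (vertex l b) (before_edge j) =
  (l == j) && (b != goN j) || (l == j.+1) && (b != goN j).
Proof.
move=> vl /[dup] lejd' /andP[_ lejd].
by rewrite /incident ends_before //= !incE //; case: b (goN j) {vl} => [] [].
Qed.

Lemma incident_after l b j : is_vertex l b -> j < d ->
  incident (vertex l b) (after_edge j) =
  (l == j) && (b == goN j) || (l == j.+1) && (b == goN j).
Proof.
by move=> vl ltjd; rewrite /incident ends_after //= !incE // ltnW.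
Qed.

(** The south and west sides join level l-1 to level l, the north and east sides level l to level
    l+1. *)
Lemma is_side_edges l e : 0 < l <= d ->
  is_side (tpos north l) e =
  (e \in [:: shared_edge l.-1; after_edge l.-1; shared_edge l; before_edge l]).
Proof.
case: l => // l /= ltld; rewrite /is_side !inE /shared_edge /after_edge /before_edge.
rewrite -tpos_vertex // /sideS /sideN /sideW /sideE /vertex /= ltld.
by case: (goN l); case: (goN l.+1); case: (tpos _ _) => X Y /=;
   do ?case: (e == _) => //=.
Qed.

Lemma edge_eq j b h l c g : is_vertex j b -> is_vertex l c ->
  ((vertex j b, h) == (vertex l c, g) :> edge) = [&& j == l, b == c & h == g].
Proof. by move=> vj vl; rewrite xpair_eqE vertex_eq // andbA. Qed.

Lemma is_side_shared l j : 0 < l <= d -> j <= d ->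
  is_side (tpos north l) (shared_edge j) = (l == j) || (l == j.+1).
Proof.
case: l => // l /= ltld lejd; rewrite is_side_edges //= !inE.
rewrite /shared_edge /after_edge /before_edge !edge_eq ?incE // ?(ltnW ltld) //.
rewrite eqSS ![_ == j]eq_sym.
(* The sides of the tile start on level l or l+1, so any other j falsifies every equality. *)
have [->|_] := eqVneq j l.+1; [|have [->|_] := eqVneq j l];
  rewrite /= ?eqxx ?(ltn_eqF (ltnSn _)) ?(gtn_eqF (ltnSn _)) //=;
  by do 2?case: (goN _).
Qed.

Lemma is_side_before l j : 0 < l <= d -> 0 < j <= d ->
  is_side (tpos north l) (before_edge j) = (l == j).
Proof.
case: l => // l /= ltld lejd; rewrite is_side_edges //= !inE.
rewrite /shared_edge /after_edge /before_edge !edge_eq ?incE // ?(ltnW ltld) //.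
rewrite ![_ == j]eq_sym.
have [->|_] := eqVneq j l.+1; [|have [->|_] := eqVneq j l];
  rewrite /= ?eqxx ?(ltn_eqF (ltnSn _)) ?(gtn_eqF (ltnSn _)) //=;
  by do 2?case: (goN _).
Qed.

Lemma is_side_after l j : 0 < l <= d -> j < d ->
  is_side (tpos north l) (after_edge j) = (l == j.+1).
Proof.
case: l => // l /= ltld ltjd; have lejd := ltnW ltjd.
rewrite is_side_edges //= !inE.
rewrite /shared_edge /after_edge /before_edge !edge_eq ?incE // ?(ltnW ltld) //.
rewrite eqSS ![_ == j]eq_sym.
have [->|_] := eqVneq j l.+1; [|have [->|_] := eqVneq j l];
  rewrite /= ?eqxx ?(ltn_eqF (ltnSn _)) ?(gtn_eqF (ltnSn _)) //=;
  by do 2?case: (goN _).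
Qed.

Lemma corners_vertices l : 0 < l <= d ->
  corners (tpos north l) =i
  [:: vertex l.-1 (goN l.-1); vertex l false; vertex l true; vertex l.+1 (~~ goN l)].
Proof.
case: l => // l /= ltld v; rewrite /corners -tpos_vertex // vertexS_up //.
rewrite /vertex /= ltld !inE.
by case: (goN l.+1); case: (tpos _ _) => X Y.
Qed.

End Geometry.

(** * Positions of the edges, sorted by level *)

Section Indexing.
Variable d : nat.
Hypothesis d_gt0 : 0 < d.

Definition shared_idx j := if j == 0 then 0 else if j == d then 3 * d else (3 * j).-1.
Definition before_idx j := if j == d then (3 * d).-1 else 3 * j.
Definition after_idx j := (3 * j).+1.

Lemma shared_idx_lt j : j <= d -> shared_idx j < nedges d.
Proof. by rewrite /shared_idx /nedges => ?; case: eqP => //; case: eqP; lia. Qed.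

Lemma before_idx_lt j : j <= d -> before_idx j < nedges d.
Proof. by rewrite /before_idx /nedges => ?; case: eqP; lia. Qed.

Lemma after_idx_lt j : j < d -> after_idx j < nedges d.
Proof. by rewrite /after_idx /nedges; lia. Qed.

Definition shared_ord j : 'I_(nedges d) := inord (shared_idx j).
Definition before_ord j : 'I_(nedges d) := inord (before_idx j).
Definition after_ord j : 'I_(nedges d) := inord (after_idx j).

Variant edge_ord_spec : 'I_(nedges d) -> Prop :=
| SharedOrd j of j <= d : edge_ord_spec (shared_ord j)
| BeforeOrd j of 0 < j <= d : edge_ord_spec (before_ord j)
| AfterOrd j of j < d : edge_ord_spec (after_ord j).

Lemma edge_ordP k : edge_ord_spec k.
Proof.
(* The quotient of k+1 by 3 is the level and the remainder the kind of edge, up to exceptions at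
   levels 0 and d. *)
have [j [r [ltr3 ek]]] : exists j r, r < 3 /\ k.+1 = 3 * j + r.
  exists (k.+1 %/ 3), (k.+1 %% 3); rewrite ltn_mod; split=> //.
  by rewrite mulnC -divn_eq.
have ltkn : k < (3 * d).+1 by case: (k).
have fold_inord (m : nat) : m = k -> k = inord m by move=> ->; rewrite inord_val.
case: r ltr3 ek => [|[|[|//]]] _ ek.
- have [ejd|njd] := eqVneq j d.
    rewrite (fold_inord (before_idx d)); last by rewrite /before_idx eqxx; lia.
    by apply: BeforeOrd; rewrite d_gt0 /=.
  rewrite (fold_inord (shared_idx j)); last by rewrite /shared_idx ifF ?ifF; lia.
  by apply: SharedOrd; lia.
- have [ejd|njd] := eqVneq j d.
    rewrite (fold_inord (shared_idx d)); last by rewrite /shared_idx eqxx ifF; lia.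
    exact: SharedOrd.
  have [ej0|nj0] := eqVneq j 0.
    rewrite (fold_inord (shared_idx 0)); last by rewrite /shared_idx eqxx; lia.
    exact: SharedOrd.
  rewrite (fold_inord (before_idx j)); last by rewrite /before_idx ifF; lia.
  by apply: BeforeOrd; lia.
- rewrite (fold_inord (after_idx j)); last by rewrite /after_idx; lia.
  by apply: AfterOrd; lia.
Qed.

(* Level j occupies the positions 3j-1, 3j, 3j+1 of [ledges], where level 0 lacks
   the first and level d the last; the shared edge is the first one of its level,
   except on the last level, where the w-edge precedes the z-edge. *)
Definition ord_fun T (fs fb fa : nat -> T) (k : 'I_(nedges d)) : T :=
  let j := k.+1 %/ 3 in
  if k.+1 %% 3 == 2 then fa j
  else if (k.+1 %% 3 == 1) == ((j == 0) || (j == d)) then fs j else fb j.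

Lemma ord_fun_shared T (fs fb fa : nat -> T) j : j <= d ->
  ord_fun fs fb fa (shared_ord j) = fs j.
Proof.
move=> lejd; rewrite /ord_fun inordK ?shared_idx_lt // /shared_idx.
have [->//|nj0] := eqVneq j 0.
have [->|njd] := eqVneq j d.
  rewrite (_ : _ %% _ = 1); last by lia.
  by rewrite (_ : _ %/ _ = d) ?eqxx ?orbT; last by lia.
rewrite (_ : _ %% _ = 0); last by lia.
rewrite (_ : _ %/ _ = j); last by lia.
by rewrite (negbTE nj0) (negbTE njd).
Qed.

Lemma ord_fun_before T (fs fb fa : nat -> T) j : 0 < j <= d ->
  ord_fun fs fb fa (before_ord j) = fb j.
Proof.
case/andP=> j0 lejd; rewrite /ord_fun inordK ?before_idx_lt // /before_idx.
have [->|njd] := eqVneq j d.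
  rewrite (_ : _ %% _ = 0); last by lia.
  by rewrite (_ : _ %/ _ = d) ?eqxx ?orbT; last by lia.
rewrite (_ : _ %% _ = 1); last by lia.
rewrite (_ : _ %/ _ = j); last by lia.
by rewrite (negbTE njd) eqn0Ngt j0.
Qed.

Lemma ord_fun_after T (fs fb fa : nat -> T) j : j < d ->
  ord_fun fs fb fa (after_ord j) = fa j.
Proof.
move=> ltjd; rewrite /ord_fun inordK ?after_idx_lt // /after_idx.
rewrite (_ : _ %% _ = 2); last by lia.
by rewrite (_ : _ %/ _ = j); last by lia.
Qed.

(** Stated for any commutative operation, because vertex degrees are sums over edges and weights are
    products. *)
Lemma big_ord_levels R (idx : R) (op : Monoid.com_law idx) (f : 'I_(nedges d) -> R) :
  \big[op/idx]_k f k =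
  \big[op/idx]_(0 <= j < d.+1)
    op (f (shared_ord j)) (op (if 0 < j then f (before_ord j) else idx)
                              (if j < d then f (after_ord j) else idx)).
Proof.
have [g gE] : exists g : nat -> R, forall k, g k = f (inord k) by exists (f \o inord).
have -> : \big[op/idx]_k f k = \big[op/idx]_(0 <= k < nedges d) g k.
  by rewrite big_mkord; apply: eq_bigr => k _; rewrite gE inord_val.
(* Level 0 has only the positions 0 and 1, level d only 3d-1 and 3d; the levels in between are full
   triples. *)
transitivity (op (op (g 0) (g 1)) (op
  (\big[op/idx]_(1 <= j < d) op (g (3 * j).-1) (op (g (3 * j)) (g (3 * j).+1)))
  (op (g (3 * d).-1) (g (3 * d))))).
  rewrite -[nedges d]/((3 * d).+1).
  have -> : (3 * d).+1 = (3 * d).-1.+2 by lia.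
  rewrite !big_nat_recr //= -!Monoid.mulmA (_ : (3 * d).-1.+1 = 3 * d); last by lia.
  have -> : \big[op/idx]_(0 <= k < (3 * d).-1) g k = op (op (g 0) (g 1))
    (\big[op/idx]_(1 <= j < d) op (g (3 * j).-1) (op (g (3 * j)) (g (3 * j).+1))).
    case: (d) d_gt0 => // n _; elim: n => [|n IHn].
      rewrite (_ : (3 * 1).-1 = 2) // [in RHS](big_geq (leqnn 1)) Monoid.mulm1.
      by rewrite !big_nat_recr //= big_geq // Monoid.mul1m.
    rewrite [in RHS](big_nat_recr n.+1) //.
    have -> : (3 * n.+2).-1 = (3 * n.+1).-1.+3 by lia.
    rewrite [in LHS]big_nat_recr // [in LHS]big_nat_recr // [in LHS]big_nat_recr // IHn -!Monoid.mulmA.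
    by have -> : (3 * n.+1).-1.+1 = 3 * n.+1 by lia.
  by rewrite !Monoid.mulmA.
rewrite big_nat_recr //= [in RHS]big_ltn // ltnn d_gt0 ltnn !Monoid.mulm1 Monoid.mul1m.
rewrite /shared_ord /before_ord /after_ord /shared_idx /before_idx /after_idx.
(* On level d the w-edge is listed before the z-edge, so the two factors are swapped. *)
rewrite -!gE !eqxx eqn0Ngt d_gt0 muln0 [op (g _) (g _.-1)]Monoid.mulmC.
rewrite -!Monoid.mulmA; congr (op _ (op _ (op _ _))).
apply: eq_big_nat => j /andP[j0 ltjd].
by rewrite j0 ltjd -!gE eqn0Ngt j0 /= (ltn_eqF ltjd).
Qed.

End Indexing.

(** * Edge and label found at each position *)

Section Labels.
Variables (L : Type) (d : nat) (north : nat -> bool) (a : L) (i av : nat -> L).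
Hypothesis d_gt0 : 0 < d.

Local Notation x0 := (sideS (tpos north 1), a).
Local Notation edge_list := (ledges d north a i av).

Lemma size_pair_edges j : size (pair_edges north i av j) = 3.
Proof. by rewrite /pair_edges; case: north. Qed.

Lemma nth_ledges_mid j r : 0 < j < d -> r < 3 ->
  nth x0 edge_list ((3 * j).-1 + r) = nth x0 (pair_edges north i av j) r.
Proof.
move=> jd ltr3; have -> : (3 * j).-1 + r = (3 * j.-1 + r).+2 by lia.
rewrite /ledges /= nth_cat size_flatten_triples; last exact: size_pair_edges.
rewrite ifT; last by lia.
rewrite nth_flatten_triples //; first by congr (nth _ (pair_edges _ _ _ _)); lia.
  exact: size_pair_edges.
by lia.
Qed.

Lemma nth_ledges_last r :
  nth x0 edge_list ((3 * d).-1 + r) =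
  nth x0 [:: (wedge d north, lab_w i); (zedge d north, lab_z a)] r.
Proof.
have -> : (3 * d).-1 + r = (3 * d.-1 + r).+2 by lia.
rewrite /ledges /= nth_cat size_flatten_triples; last exact: size_pair_edges.
by rewrite ifF ?addKn //; lia.
Qed.

(** With b = i_d, w = i_1 and z = a, the labels at the two ends continue the general pattern
    cyclically: [i j.+1] becomes [i 1] at j = d, and [i j] becomes [i d] at j = 0. *)
Definition shared_label j := if (j == 0) || (j == d) then a else av j.
Definition before_label j := if j == d then i 1 else i j.+1.
Definition after_label j := if j == 0 then i d else i j.

Lemma ledges_shared j : j <= d ->
  nth x0 edge_list (shared_ord d j) = (shared_edge d north j, shared_label j).
Proof.
move=> lejd; rewrite inordK ?shared_idx_lt // /shared_idx /shared_label.
have [->//|nj0] := eqVneq j 0.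
have [->|njd] := eqVneq j d.
  have -> : 3 * d = (3 * d).-1 + 1 by lia.
  rewrite nth_ledges_last /= /zedge /shared_edge /goN eqn0Ngt d_gt0 eqxx.
  by rewrite /vertex eqn0Ngt d_gt0 leqnn; case: odd.
have jd : 0 < j < d by lia.
rewrite -[_.-1]addn0 nth_ledges_mid // /pair_edges /shared_edge goN_mid //.
by rewrite /vertex lejd (negbTE nj0); case: north.
Qed.

Lemma ledges_before j : 0 < j <= d ->
  nth x0 edge_list (before_ord d j) = (before_edge d north j, before_label j).
Proof.
case/andP=> j0 lejd; rewrite inordK ?before_idx_lt // /before_idx /before_label.
have [->|njd] := eqVneq j d.
  rewrite -[_.-1]addn0 nth_ledges_last /= /wedge /before_edge /goN eqn0Ngt d_gt0 eqxx.
  by rewrite /vertex eqn0Ngt d_gt0 leqnn; case: odd.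
have jd : 0 < j < d by lia.
have -> : 3 * j = (3 * j).-1 + 1 by lia.
rewrite nth_ledges_mid // /pair_edges /before_edge goN_mid //.
by rewrite /vertex lejd eqn0Ngt j0; case: north.
Qed.

Lemma ledges_after j : j < d ->
  nth x0 edge_list (after_ord d j) = (after_edge d north j, after_label j).
Proof.
move=> ltjd; rewrite inordK ?after_idx_lt // /after_idx /after_label.
have [->//|nj0] := eqVneq j 0.
have jd : 0 < j < d by lia.
have -> : (3 * j).+1 = (3 * j).-1 + 2 by lia.
rewrite nth_ledges_mid // /pair_edges /after_edge -tpos_vertex // goN_mid //.
by rewrite /sideS /sideW; case: (tpos _ j.+1) => X Y; case: north.
Qed.

Lemma edge_at_shared j : j <= d ->
  edge_at north a i av (shared_ord d j) = shared_edge d north j.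
Proof. by move=> lejd; rewrite /edge_at ledges_shared. Qed.

Lemma edge_at_before j : 0 < j <= d ->
  edge_at north a i av (before_ord d j) = before_edge d north j.
Proof. by move=> lejd; rewrite /edge_at ledges_before. Qed.

Lemma edge_at_after j : j < d ->
  edge_at north a i av (after_ord d j) = after_edge d north j.
Proof. by move=> ltjd; rewrite /edge_at ledges_after. Qed.

Lemma label_at_shared j : j <= d ->
  label_at north a i av (shared_ord d j) = shared_label j.
Proof. by move=> lejd; rewrite /label_at ledges_shared. Qed.

Lemma label_at_before j : 0 < j <= d ->
  label_at north a i av (before_ord d j) = before_label j.
Proof. by move=> lejd; rewrite /label_at ledges_before. Qed.

Lemma label_at_after j : j < d ->
  label_at north a i av (after_ord d j) = after_label j.
Proof. by move=> ltjd; rewrite /label_at ledges_after. Qed.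

End Labels.

(** * Perfect matchings as padded indicator sequences *)

Section Matchings.
Variables (L : Type) (d : nat) (north : nat -> bool) (a : L) (i av : nat -> L).
Hypothesis d_gt0 : 0 < d.

Local Notation n_ := (goN d north).
Local Notation edge_ := (edge_at north a i av).
Implicit Types (P : {set 'I_(nedges d)}) (g : nat -> bool).

Lemma card_set_ord m (P : {set 'I_m}) (q : pred 'I_m) :
  #|[set k in P | q k]| = \sum_k ((k \in P) && q k : nat).
Proof. by rewrite -sum1dep_card big_mkcond; apply: eq_bigr => k _; case: ifP. Qed.

Definition bitS P j := shared_ord d j \in P.
(** The guards here and in [bitA] make the absent edges at levels 0 and d count as outside P,
    whatever index [inord] gives them. *)
Definition bitB P j := (0 < j) && (before_ord d j \in P).
Definition bitA P j := (j < d) && (after_ord d j \in P).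

Lemma eq_bits P Q :
  (forall j, j <= d -> [/\ bitS P j = bitS Q j, bitB P j = bitB Q j & bitA P j = bitA Q j]) ->
  P = Q.
Proof.
move=> eqPQ; apply/setP=> k; case: (edge_ordP d_gt0 k) => j jd.
- by case: (eqPQ j jd).
- by case/andP: jd => j0 jd; case: (eqPQ j jd); rewrite /bitB j0.
- by case: (eqPQ j (ltnW jd)); rewrite /bitA jd.
Qed.

(** Both degrees concern the edges of P between the levels j and j+1: [up_degree P j b] counts those
    at [vertex j b], [down_degree P j b] those at [vertex j.+1 b]. *)
Definition up_degree P j b : nat :=
  (bitS P j && (b == n_ j)) + (bitB P j && (b != n_ j)) + (bitA P j && (b == n_ j)).
Definition down_degree P j b : nat :=
  (bitS P j && (b != n_ j)) + (bitB P j && (b != n_ j)) + (bitA P j && (b == n_ j)).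

Lemma sum_two_levels n (U D : nat -> nat) l : l <= n.+1 ->
  \sum_(0 <= j < n.+1) ((if j == l then U j else 0) + (if j.+1 == l then D j else 0)) =
  (if l <= n then U l else 0) + (if 0 < l then D l.-1 else 0).
Proof.
move=> led1; rewrite big_split -!big_mkcond /= big_nat1_eq ltnS; congr (_ + _).
case: l led1 => [|l] led1 /=; first by rewrite big1.
by rewrite (eq_bigl (pred1 l)) // big_nat1_eq leq0n led1.
Qed.

Lemma degree_vertex P l b : is_vertex d north l b ->
  #|[set k in P | incident (vertex d north l b) (edge_ k)]| =
  (if l <= d then up_degree P l b else 0) + (if 0 < l then down_degree P l.-1 b else 0).
Proof.
move=> vlb; have led1 : l <= d.+1 by case/andP: (vlb) => /andP[].
rewrite card_set_ord big_ord_levels //.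
rewrite -(@sum_two_levels d (up_degree P ^~ b) (down_degree P ^~ b)) //.
apply: eq_big_nat => j /= ltjd; rewrite edge_at_shared // incident_shared //.
have -> : (if 0 < j then ((before_ord d j \in P) && incident (vertex d north l b)
    (edge_ (before_ord d j)) : nat) else 0) =
    bitB P j && ((l == j) && (b != n_ j) || (l == j.+1) && (b != n_ j)).
  rewrite /bitB; case: ifP => // j0.
  by rewrite edge_at_before ?incident_before // j0.
have -> : (if j < d then ((after_ord d j \in P) && incident (vertex d north l b)
    (edge_ (after_ord d j)) : nat) else 0) =
    bitA P j && ((l == j) && (b == n_ j) || (l == j.+1) && (b == n_ j)).
  rewrite /bitA; case: ifP => // j0.
  by rewrite edge_at_after ?incident_after // j0.
rewrite -/(bitS P j) /up_degree /down_degree ![_ == l]eq_sym.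
have [->|_] := eqVneq l j; first by rewrite ltn_eqF ?ltnSn //= !orbF addn0 addnA.
by have [_|_] := eqVneq l j.+1; rewrite /= ?andbF // addnA.
Qed.

Lemma perfect_matchingP P :
  reflect (forall l b, is_vertex d north l b ->
             (if l <= d then up_degree P l b else 0)
             + (if 0 < l then down_degree P l.-1 b else 0) = 1)
          (perfect_matching north a i av P).
Proof.
apply: (iffP forallP) => [PM l b vlb | PM t].
  rewrite -degree_vertex //.
  suff [t vt] : exists t : 'I_d, vertex d north l b \in corners (tile_pos north t).
    by have /allP/(_ _ vt)/eqP := PM t.
  have corner_of l' (l'd : 0 < l' <= d) : vertex d north l b \in
      [:: vertex d north l'.-1 (n_ l'.-1); vertex d north l' false;
          vertex d north l' true; vertex d north l'.+1 (~~ n_ l')] ->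
      exists t : 'I_d, vertex d north l b \in corners (tile_pos north t).
    move=> vl'; have ltl' : l'.-1 < d by lia.
    exists (Ordinal ltl'); rewrite /tile_pos /= prednK; last by lia.
    by rewrite (@corners_vertices d north d_gt0).
  case/andP: vlb => /andP[led1 l0] ld1.
  (* Level 0 is a corner of G_1, level d+1 a corner of G_d, and any other level l consists of
     corners of G_l. *)
  have [el0|nl0] := eqVneq l 0.
    apply: (corner_of 1); first by rewrite d_gt0.
    by move: l0; rewrite el0 eqxx /= => ->; rewrite inE eqxx.
  have [eld1|nld1] := eqVneq l d.+1.
    apply: (corner_of d); first by rewrite d_gt0 leqnn.
    have -> : b = ~~ n_ d by move: ld1; rewrite eld1 eqxx; move: (b) (n_ d) => [] [].
    by rewrite eld1 !inE eqxx !orbT.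
  apply: (corner_of l); first by lia.
  by rewrite !inE; case: (b); rewrite eqxx !orbT.
have ltd := ltn_ord t.
apply/allP=> v; rewrite (@corners_vertices d north d_gt0) ?ltd // !inE /=.
have vs b : is_vertex d north t.+1 b by apply: is_vertexS.
case/or4P=> /eqP->; apply/eqP; rewrite degree_vertex ?PM ?is_vertex_goN ?(ltnW ltd) //;
  exact: is_vertexS_negN.
Qed.

(* The symmetric difference of P_- and the boundary of the tiles G_j with [g j],
   provided that [g] is padded. *)
Definition matching g : {set 'I_(nedges d)} :=
  [set k | ord_fun (fun j => g j (+) g j.+1) (fun j => g j (+) par d north j)
                   (fun j => g j.+1 (+) ~~ par d north j) k].

Definition padded g := g 0 && ~~ g d.+1.

(** The membership bits of the three edges between two levels are [u (+) v], [u (+) par] and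
    [v (+) ~~ par]. Their sum is odd, so one or all three are set; the second case is excluded. *)
Definition compatible j (u v : bool) :=
  ~~ ((u (+) par d north j) && (v (+) ~~ par d north j)).

Lemma bitS_matching g j : j <= d -> bitS (matching g) j = g j (+) g j.+1.
Proof. by move=> lejd; rewrite /bitS inE ord_fun_shared. Qed.

Lemma bitB_matching g j : padded g -> j <= d ->
  bitB (matching g) j = g j (+) par d north j.
Proof.
rewrite /bitB; case/andP=> g0 _; case: j => [_|j jd] /=; first by rewrite g0.
by rewrite inE ord_fun_before.
Qed.

Lemma bitA_matching g j : padded g -> j <= d ->
  bitA (matching g) j = g j.+1 (+) ~~ par d north j.
Proof.
rewrite /bitA; case/andP=> _ /negPf gd1; case: ltngtP => // [ltjd|->] _ /=.
  by rewrite inE ord_fun_after.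
by rewrite gd1 par_last.
Qed.

(** The single edge between the levels l and l+1 meets level l where b is [g l (+) odd l], and level
    l+1 where b is the negation of [g l.+1 (+) odd l.+1]. Hence each vertex of an inner level is
    covered once, either from above or from below. *)
Lemma matching_perfect g : padded g ->
  (forall j, j <= d -> compatible j (g j) (g j.+1)) ->
  perfect_matching north a i av (matching g).
Proof.
move=> pg cg; apply/perfect_matchingP=> l b /andP[/andP[led1 l0] ld1].
have [g0 gd1] := andP pg.
have Up : l <= d -> (l == 0) ==> b -> up_degree (matching g) l b = (b == (g l (+) odd l)).
  move=> lejd _; have := cg l lejd.
  rewrite /up_degree bitS_matching // bitB_matching // bitA_matching // /compatible /par.
  by case: (g l); case: (g l.+1); case: (n_ l); case: (odd l); case: b {l0 ld1}.
have Down m : l = m.+1 -> m <= d ->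
    down_degree (matching g) m b = (b == (g m.+1 (+) odd m)).
  move=> _ lemd; have := cg m lemd.
  rewrite /down_degree bitS_matching // bitB_matching // bitA_matching // /compatible /par /=.
  by case: (g m); case: (g m.+1); case: (n_ m); case: (odd m); case: b {l0 ld1 Up}.
have [le_ld|lt_dl] := leqP l d; last first.
  have eld : l = d.+1 by lia.
  rewrite eld /= (Down d) // (negPf gd1) /=.
  by move: ld1; rewrite eld eqxx /goN eqn0Ngt d_gt0 eqxx; case: b {l0 Up Down}; case: odd.
rewrite Up //; case: l led1 l0 ld1 le_ld {Up} Down => [|l] _ l0 _ ltld Down.
  by move: l0; rewrite g0 /= => ->.
by rewrite /= Down ?(ltnW ltld) //; case: b {l0 Down}; case: (g _); case: odd.
Qed.

(* The left inverse of [matching], recovering [g j] from [before_edge j]. *)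
Definition decode P j :=
  if j == 0 then true else if j <= d then bitB P j (+) par d north j else false.

Lemma padded_decode P : padded (decode P).
Proof. by rewrite /padded /decode /= ltnn. Qed.

(** An inner level has two vertices. By induction one of them is covered from below, so exactly one
    edge leaves upwards, from the other. *)
Lemma perfect_one_edge P j : perfect_matching north a i av P -> j <= d ->
  bitS P j + bitB P j + bitA P j = 1.
Proof.
move/perfect_matchingP=> PM; elim: j => [|j IHj] lejd.
  have /PM : is_vertex d north 0 true by rewrite /is_vertex.
  by rewrite /= /up_degree /bitB /= !andbT !addn0.
have := PM _ _ (@is_vertexS d north d_gt0 _ false lejd); have := PM _ _ (@is_vertexS d north d_gt0 _ true lejd).
have := IHj (ltnW lejd).
rewrite /= lejd /up_degree /down_degree.
by case: (n_ j); case: (n_ j.+1); case: (bitS P j); case: (bitB P j); case: (bitA P j);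
   case: (bitS P j.+1); case: (bitB P j.+1); case: (bitA P j.+1).
Qed.

(** Both [after_edge j] and [before_edge j.+1] tell which vertex of level j+1 is covered from below,
    so the state of G_{j+1} can be read from either. *)
Lemma perfect_link P j : perfect_matching north a i av P -> j < d ->
  bitB P j.+1 (+) par d north j.+1 = bitA P j (+) ~~ par d north j.
Proof.
move=> PM ltjd; have := perfect_one_edge PM ltjd; have := perfect_one_edge PM (ltnW ltjd).
move/perfect_matchingP: PM => PM.
have := PM _ _ (@is_vertexS d north d_gt0 _ false ltjd).
rewrite /= ltjd /up_degree /down_degree /par /=.
by case: (n_ j); case: (n_ j.+1); case: (odd j); case: (bitS P j); case: (bitB P j);
   case: (bitA P j); case: (bitS P j.+1); case: (bitB P j.+1); case: (bitA P j.+1).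
Qed.

Lemma perfect_bits P j : perfect_matching north a i av P -> j <= d ->
  bitB P j = decode P j (+) par d north j /\
  bitA P j = decode P j.+1 (+) ~~ par d north j.
Proof.
move=> PM lejd; split.
  rewrite /decode; have [->|nj0] := eqVneq j 0; first by rewrite /bitB par0.
  by rewrite lejd -addbA addbb addbF.
rewrite /decode /=; case: ltngtP lejd => // [ltjd|->] _.
  by rewrite perfect_link // -addbA addbb addbF.
by rewrite par_last // /bitA ltnn.
Qed.

Lemma perfect_compatible P j : perfect_matching north a i av P -> j <= d ->
  compatible j (decode P j) (decode P j.+1).
Proof.
move=> PM lejd; rewrite /compatible; have [<- <-] := perfect_bits PM lejd.
have := perfect_one_edge PM lejd.
by case: (bitS P j); case: (bitB P j); case: (bitA P j).
Qed.

Lemma perfect_decodeK P : perfect_matching north a i av P -> matching (decode P) = P.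
Proof.
move=> PM; apply: eq_bits => j lejd.
have pP := padded_decode P.
rewrite bitS_matching // bitB_matching // bitA_matching //.
have [eB eA] := perfect_bits PM lejd; have one := perfect_one_edge PM lejd.
(* Exactly one of the three bits is set, so the bit of the shared edge follows from the other
   two. *)
split; rewrite -?eB -?eA //; move: one eB eA.
by case: (bitS P j); case: (bitB P j); case: (bitA P j); case: (par _ _ j);
   case: (decode P j); case: (decode P j.+1).
Qed.

Lemma decode_matching g j : padded g -> j <= d.+1 -> decode (matching g) j = g j.
Proof.
move=> pg; rewrite /decode; have [g0 /negPf gd1] := andP pg.
have [->|nj0] := eqVneq j 0; first by rewrite g0.
rewrite leq_eqVlt => /predU1P[->|ltjd]; first by rewrite ltnn gd1.
by rewrite -ltnS ltjd bitB_matching // -addbA addbb addbF.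
Qed.

Lemma eq_matching g h : padded g -> padded h -> (forall j, 0 < j <= d -> g j = h j) ->
  matching g = matching h.
Proof.
move=> pg ph eq_gh.
have gh j : j <= d.+1 -> g j = h j.
  have [[g0 /negPf gd1] [h0 /negPf hd1]] := (andP pg, andP ph).
  have [->|nj0] := eqVneq j 0; first by rewrite g0 h0.
  by rewrite leq_eqVlt => /predU1P[->|ltjd]; [rewrite gd1 hd1 | apply: eq_gh; lia].
apply: eq_bits => j lejd; rewrite !bitS_matching // !bitB_matching // !bitA_matching //.
by rewrite !gh // ltnW.
Qed.

(** No other position carries this edge: the starting level fixes j, and the orientation differs
    from that of the two other edges starting there. *)
Lemma exists_shared P j : j <= d ->
  [exists k in P, edge_ k == shared_edge d north j] = bitS P j.
Proof.
move=> lejd; apply/existsP/idP => [[k /andP[]]|Pj]; last first.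
  by exists (shared_ord d j); rewrite edge_at_shared // eqxx andbT.
case: (edge_ordP d_gt0 k) => l ld kP.
- rewrite edge_at_shared // /shared_edge edge_eq ?is_vertex_goN //.
  by case/and3P=> /eqP <-.
- rewrite edge_at_before // /shared_edge /before_edge edge_eq ?is_vertex_goN ?is_vertex_negN //.
  by case/and3P=> /eqP <-; case: (n_ l).
- rewrite edge_at_after // /shared_edge /after_edge edge_eq ?is_vertex_goN ?(ltnW ld) //.
  by case/and3P=> /eqP <-; case: (n_ l).
Qed.

Lemma exists_south P :
  [exists k in P, edge_ k == sideS (tpos north 1)] = bitS P 0.
Proof. by rewrite -exists_shared. Qed.

Lemma exists_zedge P : [exists k in P, edge_ k == zedge d north] = bitS P d.
Proof.
rewrite -exists_shared // /zedge /shared_edge /goN /vertex eqn0Ngt d_gt0 eqxx leqnn /=.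
by case: odd.
Qed.

(** * Enclosed tiles and the minimal matching *)

Definition tiles g : {set 'I_d} := [set t : 'I_d | g t.+1].

(** The flag [U] says that the edge is a side of G_{j+1}, the flag [D] that it is a side of G_j. *)
Lemma sum_tiles g (U D : bool) j (q : pred 'I_d) : j <= d ->
  (forall t : 'I_d, q t = U && (t == j :> nat) || D && (t.+1 == j)) ->
  #|[set t in tiles g | q t]| = ([&& U, j < d & g j.+1] + [&& D, 0 < j & g j])%N.
Proof.
move=> lejd qE; rewrite card_set_ord.
have lejd' : j <= d.-1.+1 by rewrite prednK.
have := @sum_two_levels d.-1 (fun t => U && g t.+1) (fun t => D && g t.+1) j lejd'.
rewrite prednK // big_mkord => sumE.
transitivity (\sum_(t < d) ((if t == j :> nat then (U && g t.+1 : nat) else 0) +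
                            (if t.+1 == j then (D && g t.+1 : nat) else 0))).
  apply: eq_bigr => t _; rewrite inE qE.
  have [->|_] := eqVneq (t : nat) j; last first.
    by rewrite andbF /=; case: (_ == j); rewrite ?andbT ?andbF // andbC.
  by rewrite gtn_eqF ?ltnSn // andbT andbF orbF addn0 andbC.
rewrite sumE; congr (_ + _).
  have -> : (j <= d.-1) = (j < d) by lia.
  by case: (j < d); rewrite ?andbF.
by case: j {lejd lejd' qE sumE} => [|j] /=; rewrite ?andbF.
Qed.

Lemma card_tiles_shared g j : j <= d ->
  #|[set t in tiles g | is_side (tile_pos north t) (edge_ (shared_ord d j))]| =
  ((j < d) && g j.+1) + ((0 < j) && g j).
Proof.
move=> lejd; rewrite (@sum_tiles g true true j) // => t.
by rewrite edge_at_shared // is_side_shared ?ltn_ord //= eqSS orbC.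
Qed.

Lemma card_tiles_before g j : 0 < j <= d ->
  #|[set t in tiles g | is_side (tile_pos north t) (edge_ (before_ord d j))]| = g j.
Proof.
move=> jd; have /andP[j0 lejd] := jd.
rewrite (@sum_tiles g false true j) //= ?j0 // => t.
by rewrite edge_at_before // is_side_before ?ltn_ord.
Qed.

Lemma card_tiles_after g j : j < d ->
  #|[set t in tiles g | is_side (tile_pos north t) (edge_ (after_ord d j))]| = g j.+1.
Proof.
move=> ltjd; rewrite (@sum_tiles g true false j) ?(ltnW ltjd) //= ?ltjd ?addn0 // => t.
by rewrite edge_at_after // is_side_after ?ltn_ord // orbF.
Qed.

Lemma boundary_edgeE (k : 'I_(nedges d)) : boundary_edge north a i av k =
  (#|[set t in tiles xpredT | is_side (tile_pos north t) (edge_ k)]| == 1).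
Proof. by congr (#|pred_of_set _| == 1); apply/setP=> t; rewrite !inE. Qed.

(** The empty set of tiles; its only nonzero value is the padding at 0. *)
Definition no_tile : nat -> bool := eq_op 0.

Lemma padded_no_tile : padded no_tile. Proof. by []. Qed.

Lemma compatible_no_tile j : compatible j (no_tile j) (no_tile j.+1).
Proof.
rewrite /compatible /no_tile; case: j => [|j]; first by rewrite par0.
by case: par.
Qed.

Lemma Pmin_spec_no_tile : Pmin_spec north a i av (matching no_tile).
Proof.
have pn := padded_no_tile; apply/and3P; split.
- by apply: matching_perfect => // j _; apply: compatible_no_tile.
- apply/forall_inP=> k; case: (edge_ordP d_gt0 k) => j jd; rewrite boundary_edgeE.
  + rewrite -/(bitS _ j) bitS_matching // card_tiles_shared // !andbT /no_tile /=.
    by case: j jd => // j _; rewrite d_gt0.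
  + by rewrite card_tiles_before.
  + by rewrite card_tiles_after.
- by rewrite exists_south bitS_matching.
Qed.

(** The south edge forces g 1 = 0, and a later change from 0 to 1 would put an edge shared by two
    tiles into P. *)
Lemma Pmin_spec_unique P : Pmin_spec north a i av P -> P = matching no_tile.
Proof.
case/and3P=> PM /forall_inP bP; rewrite exists_south => P0.
rewrite -(perfect_decodeK PM) in bP P0 *.
have pP := padded_decode P; set g := decode P in bP P0 pP *.
apply: eq_matching => // j /andP[]; elim: j => // j IHj _ lejd.
case: j => [|j] in IHj lejd *.
  by move: P0; rewrite bitS_matching //; case/andP: pP => -> _; case: (g 1).
have gj : g j.+1 = false := IHj isT (ltnW lejd).
apply/negbTE/negP=> gj2; have := bP (shared_ord d j.+1).
rewrite -/(bitS _ j.+1) bitS_matching ?(ltnW lejd) // gj gj2 boundary_edgeE.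
by rewrite card_tiles_shared ?(ltnW lejd) // lejd => /(_ isT).
Qed.

Lemma PminE : Pmin d north a i av = matching no_tile.
Proof.
rewrite /Pmin; case: pickP => [P /Pmin_spec_unique // | /(_ (matching no_tile))].
by rewrite Pmin_spec_no_tile.
Qed.

(** The parity bits of g and [no_tile] cancel, which leaves on each edge the number modulo 2 of
    chosen tiles that it bounds. *)
Lemma tiles_boundary_tiles g : padded g ->
  tiles_boundary north a i av (tiles g) = symdiff (matching g) (Pmin d north a i av).
Proof.
move=> pg; have pn := padded_no_tile; rewrite PminE.
have [g0 /negPf gd1] := andP pg.
have symdiffE P Q k : (k \in symdiff P Q) = (k \in P) (+) (k \in Q).
  by rewrite !inE; case: (k \in P); case: (k \in Q).
apply: eq_bits => j lejd; split.
- have eS h : (shared_ord d j \in matching h) = h j (+) h j.+1 := bitS_matching h lejd.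
  rewrite /bitS symdiffE !eS inE card_tiles_shared //.
  rewrite /no_tile oddD !oddb.
  case: j lejd {eS} => [|j] lejd /=; first by rewrite d_gt0 g0; case: (g 1).
  rewrite addbF addbC; congr (_ (+) _).
  by case: (ltngtP j.+1 d) lejd => // ->; rewrite gd1.
- rewrite /bitB symdiffE; case: (posnP j) => //= j0.
  have jd : 0 < j <= d by rewrite j0.
  have eB h : padded h -> (before_ord d j \in matching h) = h j (+) par d north j.
    by move=> ph; rewrite -bitB_matching // /bitB j0.
  rewrite !eB // inE card_tiles_before // oddb /no_tile eq_sym (gtn_eqF j0).
  by rewrite addFb -addbA addbb addbF.
- rewrite /bitA symdiffE; case: (ltnP j d) => //= ltjd.
  have eA h : padded h -> (after_ord d j \in matching h) = h j.+1 (+) ~~ par d north j.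
    by move=> ph; rewrite -bitA_matching // /bitA ltjd.
  rewrite !eA // inE card_tiles_after // oddb /no_tile.
  by rewrite addFb -addbA addbb addbF.
Qed.

(** Membership of a tile in J is read off its [before_edge], a side of no other tile. *)
Lemma tiles_boundary_inj : injective (tiles_boundary (d := d) north a i av).
Proof.
have eJ (J : {set 'I_d}) (t : 'I_d) :
    (before_ord d t.+1 \in tiles_boundary north a i av J) = (t \in J).
  have -> : J = tiles (fun j => [exists s in J, s.+1 == j]).
    apply/setP=> s; rewrite inE; apply/idP/exists_inP=> [sJ|[u uJ]]; first by exists s.
    by rewrite eqSS => /eqP/val_inj <-.
  by rewrite inE card_tiles_before ?ltn_ord // oddb inE.
by move=> J K eqJK; apply/setP=> t; rewrite -!eJ eqJK.
Qed.

Lemma enclosed_matching g : padded g -> enclosed north a i av (matching g) = tiles g.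
Proof.
move=> pg; rewrite /enclosed; case: pickP => [J /eqP|/(_ (tiles g))].
  by rewrite -tiles_boundary_tiles // => /tiles_boundary_inj.
by rewrite tiles_boundary_tiles // eqxx.
Qed.

End Matchings.

(** * Sums over two-state paths *)

Section TransferMatrix.

Definition ffun_rcons (T : Type) n (f : {ffun 'I_n -> T}) (c : T) : {ffun 'I_n.+1 -> T} :=
  [ffun k => if unlift ord_max k is Some k' then f k' else c].

Lemma ffun_rcons_max (T : Type) n (f : {ffun 'I_n -> T}) c : ffun_rcons f c ord_max = c.
Proof. by rewrite ffunE unlift_none. Qed.

Lemma ffun_rcons_lift (T : Type) n (f : {ffun 'I_n -> T}) c k :
  ffun_rcons f c (lift ord_max k) = f k.
Proof. by rewrite ffunE liftK. Qed.

Lemma ffun_rcons_inord (T : Type) n (f : {ffun 'I_n.+1 -> T}) c k : k <= n ->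
  ffun_rcons f c (inord k) = f (inord k).
Proof.
move=> lekn; rewrite -(ffun_rcons_lift f c (inord k)); congr (ffun_rcons f c _).
by apply: ord_inj; rewrite lift_max !inordK // ltnS leqW.
Qed.

Lemma ffun_rcons_inord_max (T : Type) n (f : {ffun 'I_n -> T}) c :
  ffun_rcons f c (inord n) = c.
Proof. by rewrite -[RHS](ffun_rcons_max f); congr (ffun_rcons f c _); apply/val_inj/inordK. Qed.

Local Open Scope ring_scope.

Lemma sum_ffun_rcons (V : nmodType) (T : finType) n (F : {ffun 'I_n.+1 -> T} -> V) :
  \sum_f F f = \sum_(f : {ffun 'I_n -> T}) \sum_c F (ffun_rcons f c).
Proof.
rewrite pair_big /= (reindex (fun p : {ffun 'I_n -> T} * T => ffun_rcons p.1 p.2)) //=.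
exists (fun f : {ffun 'I_n.+1 -> T} => ([ffun k => f (lift ord_max k)], f ord_max)).
  move=> [f c] _ /=; rewrite ffun_rcons_max; congr (_, _).
  by apply/ffunP=> k; rewrite ffunE ffun_rcons_lift.
move=> f _; apply/ffunP=> k /=; case: (unliftP ord_max k) => [k'|] ->.
  by rewrite ffun_rcons_lift ffunE.
by rewrite ffun_rcons_max.
Qed.

Variable R : comNzRingType.
Variable T : nat -> bool -> bool -> R.

(** This is the entry at (u, v) of the matrix product of T 0, ..., T (n-1). *)
Fixpoint path_sum n (u v : bool) : R :=
  if n is n'.+1 then \sum_w path_sum n' u w * T n' w v else (u == v)%:R.

(** The end weight [h] is arbitrary so that the induction can absorb the last transition into it. *)
Lemma sum_paths n (h : bool -> bool -> R) :
  \sum_(f : {ffun 'I_n.+1 -> bool}) h (f (inord 0)) (f (inord n)) *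
     \prod_(0 <= k < n) T k (f (inord k)) (f (inord k.+1)) =
  \sum_u \sum_v h u v * path_sum n u v.
Proof.
elim: n h => [|n IHn] h.
  rewrite sum_ffun_rcons (big_pred1 [ffun _ => false]); last first.
    by move=> f; apply/esym/eqP/ffunP; case.
  apply: eq_bigr => c _; rewrite ffun_rcons_inord_max big_geq // big_bool /=.
  by case: c; rewrite /= !mulr1 mulr0 ?addr0 ?add0r.
rewrite sum_ffun_rcons.
pose h' u v := \sum_c h u c * T n v c.
transitivity (\sum_(f : {ffun 'I_n.+1 -> bool}) h' (f (inord 0)) (f (inord n)) *
     \prod_(0 <= k < n) T k (f (inord k)) (f (inord k.+1))).
  apply: eq_bigr => f _; rewrite mulr_suml; apply: eq_bigr => c _.
  rewrite big_nat_recr //= ffun_rcons_inord_max !ffun_rcons_inord //.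
  rewrite [LHS]mulrCA [LHS]mulrC; congr (_ * _).
  by apply: eq_big_nat => k /= ltkn; rewrite !ffun_rcons_inord // ltnW.
rewrite IHn; apply: eq_bigr => u _ /=.
by rewrite /h' !big_bool /=; ring.
Qed.

End TransferMatrix.

(** * Weights, heights and the trace formula *)

Section BandSum.
Variables (L : Type) (F : fieldType) (x y : L -> F).
Variables (n : nat) (north : nat -> bool) (a : L) (i av : nat -> L).
Hypothesis x_neq0 : forall l, x l != 0%R.

Local Notation d := n.+1.
Local Notation par_ := (par d north).
Local Notation matching_ := (matching d north).

Definition pad (f : {ffun 'I_d -> bool}) j :=
  if j == 0 then true else if j <= d then f (inord j.-1) else false.

Lemma padded_pad f : padded d (pad f).
Proof. by rewrite /padded /pad ltnn. Qed.

Lemma pad_ord f (t : 'I_d) : pad f t.+1 = f t.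
Proof. by rewrite /pad /= ltn_ord inord_val. Qed.

Local Open Scope ring_scope.

Definition level_weight j (u v : bool) : F :=
  (if u (+) v then x (shared_label d a av j) else 1) *
  ((if u (+) par_ j then x (before_label d i j) else 1) *
   (if v (+) ~~ par_ j then x (after_label d i j) else 1)).

Lemma weight_matching g : padded d g ->
  weight north a i av x (matching_ g) =
  \prod_(0 <= j < d.+1) level_weight j (g j) (g j.+1).
Proof.
move=> pg; rewrite /weight big_mkcond big_ord_levels //=.
apply: eq_big_nat => j /= lejd.
rewrite -/(bitS _ j) bitS_matching // label_at_shared //; congr (_ * (_ * _)).
  rewrite -(@bitB_matching d north isT) // /bitB; case: posnP => //= j0.
  by rewrite label_at_before // j0.
rewrite -(@bitA_matching d north isT) // /bitA; case: ltnP => //= ltjd.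
by rewrite label_at_after.
Qed.

Lemma height_matching g : padded d g ->
  height north a i av y (matching_ g) =
  \prod_(1 <= j < d.+1) (if g j then y (i j) else 1).
Proof.
move=> pg; rewrite /height enclosed_matching // big_mkcond big_add1 big_mkord.
by apply: eq_bigr => t _; rewrite inE.
Qed.

(** The padding makes the levels 0 and d compatible, as [par] holds at both, so the steps between
    tiles remain. *)
Lemma perfect_matching_all g : padded d g ->
  perfect_matching north a i av (matching_ g) =
  all (fun j => compatible d north j (g j) (g j.+1)) (index_iota 1 d).
Proof.
move=> pg; apply/idP/allP=> [PM j | cg].
  rewrite mem_index_iota => /andP[_ ltjd].
  rewrite -(@decode_matching d north isT g _ pg (leqW ltjd)).
  by rewrite -(@decode_matching d north isT g _ pg (leqW (ltnW ltjd))) (perfect_compatible (ltn0Sn n) PM) // ltnW.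
apply: matching_perfect => // j lejd; have [g0 /negPf gd1] := andP pg.
have [->|nj0] := eqVneq j 0%N; first by rewrite /compatible g0 par0.
have [->|njd] := eqVneq j d; first by rewrite /compatible gd1 par_last // andbF.
by apply: cg; rewrite mem_index_iota; lia.
Qed.

Lemma in_S_matching g : padded d g ->
  in_S north a i av (matching_ g) =
  all (fun j => compatible d north j (g j) (g j.+1)) (index_iota 1 d) && (~~ g 1%N || g d).
Proof.
move=> pg; rewrite /in_S perfect_matching_all // exists_south // exists_zedge //.
rewrite !bitS_matching //; have [g0 /negPf gd1] := andP pg.
by rewrite g0 gd1 addbF addTb.
Qed.

Lemma sum_in_S (V : nmodType) (G : {set 'I_(nedges d)} -> V) :
  \sum_(P | in_S north a i av P) G P =
  \sum_(f | in_S north a i av (matching_ (pad f))) G (matching_ (pad f)).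
Proof.
have decP P j : perfect_matching north a i av P -> (0 < j <= d)%N ->
    pad [ffun t : 'I_d => decode north P t.+1] j = decode north P j.
  move=> PM; case: j => // j /= ltjd; rewrite /pad /= ltjd ffunE inordK //.
rewrite (reindex_onto (fun f => matching_ (pad f))
                      (fun P => [ffun t : 'I_d => decode north P t.+1])).
  apply: eq_bigl => f; rewrite andbC; case: eqP => //= -[].
  apply/ffunP=> t; rewrite ffunE decode_matching ?pad_ord ?padded_pad //.
  by have := ltn_ord t; lia.
move=> P /andP[PM _]; rewrite -[RHS](perfect_decodeK (ltn0Sn n) PM) //.
apply: eq_matching; rewrite ?padded_pad ?padded_decode // => j jd.
exact: decP.
Qed.

(** The height of G_j is charged to the step that leaves it, so the height of G_d is left to
    [closing]. *)
Definition transfer j (u v : bool) : F :=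
  (compatible d north j u v)%:R * (level_weight j u v * (if u then y (i j) else 1)).

(* The transition from G_d back to G_1 in the band graph; [u] is the state of G_1,
   [v] that of G_d. *)
Definition closing (u v : bool) : F :=
  if u then (if v then x (i d) * y (i d) else 0)
  else (if v then x a * y (i d) else x (i 1%N)).

Lemma prod_indicator (s : seq nat) (b : nat -> bool) :
  \prod_(j <- s) (b j)%:R = (all b s)%:R :> F.
Proof.
elim: s => [|j s IHs] /=; first by rewrite big_nil.
by rewrite big_cons IHs; case: (b j); rewrite ?mul1r ?mul0r.
Qed.

(** Levels 0 and d and the height of G_d, divided by [x a], multiply to [closing]; its zero entry is
    the pair that membership in S excludes. *)
Lemma term_matching g : padded d g ->
  (if in_S north a i av (matching_ g)
   then weight north a i av x (matching_ g) * height north a i av y (matching_ g) / x a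
   else 0) =
  closing (g 1%N) (g d) * \prod_(1 <= j < d) transfer j (g j) (g j.+1).
Proof.
move=> pg; have [g0 /negPf gd1] := andP pg.
rewrite in_S_matching // weight_matching // height_matching //.
(* The lock keeps [big_split] from splitting the level weights themselves. *)
rewrite /transfer [level_weight]lock !big_split /= prod_indicator.
case: all; rewrite /= ?mul0r ?mulr0 // mul1r.
rewrite (big_nat_recr d) // (big_nat_recr d _ (fun j => if g j then _ else _)) //=.
rewrite (big_ltn (n := d)) //= g0 gd1.
set W := \prod_(1 <= j < n.+1) locked _ _ _ _; set H := \prod_(1 <= j < n.+1) _.
rewrite -lock /level_weight par0 // par_last // /shared_label /before_label /after_label !eqxx /= ?eqxx ?orbT /=.
rewrite /closing; have xa := x_neq0 a.
by case: (g 1%N); case: (g n.+1) => /=; rewrite ?mul0r //; field.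
Qed.

Lemma sum_in_S_transfer :
  \sum_(P : {set 'I_(nedges d)} | in_S north a i av P)
      weight north a i av x P * height north a i av y P / x a =
  \sum_u \sum_v closing u v * path_sum (fun j => transfer j.+1) n u v.
Proof.
rewrite sum_in_S big_mkcond -sum_paths; apply: eq_bigr => f _.
rewrite term_matching ?padded_pad // big_add1 /pad /= leqnn; congr (_ * _).
by apply: eq_big_nat => j /= ltjn; rewrite !ltnS ltjn ltnW.
Qed.

Definition ord2 (b : bool) : 'I_2 := if b then 1 else 0.

Lemma mx2E (p q r s : F) u v :
  mx2 p q r s (ord2 u) (ord2 v) =
  if u then (if v then s else r) else (if v then q else p).
Proof. by rewrite mxE; case: u; case: v. Qed.

Lemma sum_ord2 (f : 'I_2 -> F) : \sum_k f k = \sum_b f (ord2 b).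
Proof.
rewrite !big_ord_recl big_ord0 addr0 big_bool addrC.
by congr (f _ + f _); apply: val_inj.
Qed.

Lemma mulmx_ord2 (A B : 'M[F]_2) u v :
  (A *m B) (ord2 u) (ord2 v) = \sum_w A (ord2 u) (ord2 w) * B (ord2 w) (ord2 v).
Proof. by rewrite mxE sum_ord2. Qed.

(* [mj j] is the transfer matrix, with rows indexed by the later tile,
   rescaled on both sides by diagonal matrices. *)
Lemma mj_transfer j u v : (0 < j < d)%N ->
  mj north i av x y j (ord2 v) (ord2 u) =
  (if v then (x (i j.+1))^-1 else 1) * transfer j u v * (if u then 1 else (x (i j))^-1).
Proof.
move=> jd; have /andP[/gtn_eqF j0 /ltn_eqF jd'] := jd.
rewrite /transfer /level_weight /compatible /shared_label /before_label /after_label.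
rewrite j0 jd' /= /mj /par goN_mid //.
have xj := x_neq0 (i j); have xj1 := x_neq0 (i j.+1).
by case: (odd j); case: (north j); rewrite /= mx2E; case: u; case: v => /=;
   rewrite ?(mulr0, mul0r, mul1r, mulr1) //; field; rewrite ?xj ?xj1.
Qed.

(** An inner tile is rescaled by the inverse of its [x] exactly once, from the later matrix in state
    0 and from the earlier one in state 1. The product of the [x (i j)] clears these inverses; the
    end tiles keep a factor depending on their state. *)
Lemma Mrec_path_sum k u v : (k < d)%N ->
  Mrec north i av x y k (ord2 v) (ord2 u) * \prod_(1 <= j < k.+2) x (i j) =
  (if v then 1 else x (i k.+1)) * (if u then x (i 1%N) else 1) *
  path_sum (fun j => transfer j.+1) k u v.
Proof.
elim: k v => [|k IHk] v ltkd.
  rewrite big_nat1 mxE /=.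
  by case: u; case: v; rewrite /= ?(mul0r, mulr0, mul1r, mulr1).
rewrite big_nat_recr //= mulmx_ord2 mulrA mulr_suml mulr_suml mulr_sumr.
apply: eq_bigr => w _.
rewrite -[_ * _ * \prod_(_ <= _ < _) _]mulrA IHk ?(ltnW ltkd) // mj_transfer //.
have xk := x_neq0 (i k.+1); have xk1 := x_neq0 (i k.+2).
by case: w; case: v; field; rewrite ?xk ?xk1.
Qed.

(** The trace identifies the outer indices, and the factors left at the two end tiles turn the
    entries of the extra matrix into [closing]. *)
Lemma trace_path_sum :
  (\prod_(1 <= j < d.+1) x (i j)) *
    \tr (mx2 (x (i 1%N) / x (i d)) (x a * y (i d))
             0 (y (i d) * x (i d) / x (i 1%N))
         *m Md d north i av x y) =
  \sum_u \sum_v closing u v * path_sum (fun j => transfer j.+1) n u v.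
Proof.
rewrite /mxtrace sum_ord2 mulr_sumr; apply: eq_bigr => u _.
rewrite mulmx_ord2 mulr_sumr; apply: eq_bigr => v _.
rewrite mulrCA [X in _ * X]mulrC Mrec_path_sum // mx2E /closing.
have x1 := x_neq0 (i 1%N); have xd := x_neq0 (i d).
by case: u; case: v; field; rewrite ?x1 ?xd.
Qed.

End BandSum.

Local Open Scope ring_scope.

Theorem mainTheorem5 (L : Type) (F : fieldType) (x y : L -> F)
    (d : nat) (north : nat -> bool) (a : L) (i av : nat -> L) :
  (1 <= d)%N ->
  (forall l : L, x l != 0) ->
  \sum_(P : {set 'I_(nedges d)} | in_S north a i av P)
      weight north a i av x P * height north a i av y P / x a
  = (\prod_(1 <= j < d.+1) x (i j)) *
    \tr (mx2 (x (i 1%N) / x (i d)) (x a * y (i d))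
             0 (y (i d) * x (i d) / x (i 1%N))
         *m Md d north i av x y).
Proof.
case: d => // n _ x_neq0.
by rewrite sum_in_S_transfer // trace_path_sum.
Qed.
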